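(* Let $\mu$ be a finite Borel measure on $\mathbb{R}^n$ and $\Lambda\subset\mathbb{R}^n$. Then $\{e_\lambda\}_{\lambda\in\Lambda}$ is orthonormal in $L^2(\mu)$ if and only if there is a linear isometry $W_\Lambda$ from $\mathcal{H}_\Lambda:=\overline{\operatorname{span}}\{e_\lambda:\lambda\in\Lambda\}\subset L^2(\mu)$ into $L^2(G,\mu_{Bohr})$ with $W_\Lambda e_\lambda=\tilde e_\lambda$ for all $\lambda\in\Lambda$.
   Context: $e_\lambda(x)=e^{2\pi i\lambda\cdot x}$. The Bohr compactification $G$ of $\mathbb{R}^n$ is the dual group of $\mathbb{R}^n$ with the discrete topology: the set of all group homomorphisms $\chi:\mathbb{R}^n\to\mathbb{T}=\{z\in\mathbb{C}:|z|=1\}$, with pointwise multiplication and the topology of pointwise convergence; it is a compact abelian group and $\mu_{Bohr}$ denotes its normalized Haar measure. For $\lambda\in\mathbb{R}^n$, $\tilde e_\lambda:G\to\mathbb{T}$ is the character $\tilde e_\lambda(\chi)=\chi(\lambda)$. $\mathbb{R}^n$ embeds in $G$ via $\xi(x)(\lambda)=e^{2\pi i\lambda\cdot x}$. *)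

(* Defs.v *)
From HB Require Import structures.
From mathcomp Require Import all_boot all_order all_algebra.
From mathcomp Require Import all_classical all_reals all_analysis.
From mathcomp Require Import complex.
Import Order.TTheory GRing.Theory Num.Theory.
Import numFieldNormedType.Exports.

Set Implicit Arguments.
Unset Strict Implicit.
Unset Printing Implicit Defensive.

Local Open Scope ring_scope.
Local Open Scope classical_set_scope.

(** Complex numbers C = R[i], seen as a numFieldType so that it carries its
    norm topology. *)
Definition Cplx (R : realType) : numFieldType := R[i].

Definition dotR (R : realType) (n : nat) (x y : 'rV[R]_n) : R :=
  \sum_(i < n) x ord0 i * y ord0 i.

Definition cexpi (R : realType) (t : R) : Cplx R := (cos t +i* sin t)%C.

Definition expo (R : realType) (n : nat) (lam : 'rV[R]_n) : 'rV[R]_n -> Cplx R :=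
  fun x => cexpi (2 * pi * dotR lam x).

Notation borelRn R n := (g_sigma_algebraType (@open 'rV[R]_n)).

(** Bohr compactification: group homomorphisms (R^n,+) -> T (unit circle),
    with the topology of pointwise convergence (subspace of the product
    topology on functions R^n -> C). *)
Definition is_char (R : realType) (n : nat) (chi : 'rV[R]_n -> Cplx R) : Prop :=
  (forall x, `|chi x| = 1) /\ (forall x y, chi (x + y) = chi x * chi y).

Definition bohr_set (R : realType) (n : nat) : set {ptws 'rV[R]_n -> Cplx R} :=
  [set chi | is_char chi].

Definition bohr (R : realType) (n : nat) : Type := set_type (@bohr_set R n).
HB.instance Definition _ (R : realType) (n : nat) :=
  Choice.on (bohr R n).

Lemma one_is_char (R : realType) (n : nat) :
  (fun _ : 'rV[R]_n => (1 : Cplx R)) \in @bohr_set R n.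
Proof. by rewrite inE; split=> [x|x y]; rewrite ?normr1 ?mulr1. Qed.

Definition bohr_one (R : realType) (n : nat) : bohr R n :=
  exist _ (fun _ : 'rV[R]_n => (1 : Cplx R)) (one_is_char R n).

HB.instance Definition _ (R : realType) (n : nat) :=
  isPointed.Build (bohr R n) (bohr_one R n).
HB.instance Definition _ (R : realType) (n : nat) :=
  Topological.copy (bohr R n) (set_type (@bohr_set R n)).

Notation bohrB R n := (g_sigma_algebraType (@open (bohr R n))).

Definition texpo (R : realType) (n : nat) (lam : 'rV[R]_n) : bohrB R n -> Cplx R :=
  fun chi => sval chi lam.

Definition bohr_translate (R : realType) (n : nat) (g : bohr R n) (A : set (bohr R n))
  : set (bohr R n) :=
  [set h | exists2 a, A a & forall x, sval h x = sval g x * sval a x].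

Definition is_haar (R : realType) (n : nat) (m : probability (bohrB R n) R) : Prop :=
  (forall (g : bohr R n) (A : set (bohr R n)),
      measurable (A : set (bohrB R n)) ->
      m (bohr_translate g A : set (bohrB R n)) = m (A : set (bohrB R n))) /\
  (forall A : set (bohr R n), measurable (A : set (bohrB R n)) ->
      m (A : set (bohrB R n)) =
      ereal_sup [set m (K : set (bohrB R n)) | K in
                   [set K : set (bohr R n) | compact K /\ K `<=` A]]).

Definition cmeasurable (d : measure_display) (X : measurableType d) (R : realType)
  (f : X -> Cplx R) : Prop :=
  measurable_fun setT (fun x => @complex.Re R (f x)) /\ measurable_fun setT (fun x => @complex.Im R (f x)).

Definition sqnorm (d : measure_display) (X : measurableType d) (R : realType)
  (m : {measure set X -> \bar R}) (f : X -> Cplx R) : \bar R :=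
  (\int[m]_x ((@complex.Re R (f x)) ^+ 2 + (@complex.Im R (f x)) ^+ 2)%:E)%E.

Definition L2 (d : measure_display) (X : measurableType d) (R : realType)
  (m : {measure set X -> \bar R}) (f : X -> Cplx R) : Prop :=
  cmeasurable f /\ (sqnorm m f < +oo)%E.

Definition cinner (d : measure_display) (X : measurableType d) (R : realType)
  (m : {measure set X -> \bar R}) (f g : X -> Cplx R) : Cplx R :=
  (Rintegral m setT (fun x => @complex.Re R (f x * conjc (g x))) +i*
   Rintegral m setT (fun x => @complex.Im R (f x * conjc (g x))))%C.

Definition orthonormal_exp (R : realType) (n : nat)
  (m : {measure set borelRn R n -> \bar R}) (Lam : set 'rV[R]_n) : Prop :=
  forall lam lam', Lam lam -> Lam lam' ->
    cinner m (expo lam) (expo lam') = (if lam == lam' then 1 else 0).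

Definition in_H (R : realType) (n : nat)
  (m : {measure set borelRn R n -> \bar R}) (Lam : set 'rV[R]_n)
  (f : borelRn R n -> Cplx R) : Prop :=
  L2 m f /\
  forall eps : R, 0 < eps -> exists s : seq (Cplx R * 'rV[R]_n),
    (forall p, p \in s -> Lam p.2) /\
    (sqnorm m (fun x => (f x - \sum_(p <- s) p.1 * expo p.2 x)%R) < eps%:E)%E.

(** W is a linear isometry from H_Lam into L^2(G, mB) with W e_lambda =
    tilde e_lambda. W acts on representatives; equalities in L^2 are
    equalities up to a null L^2-norm. *)
Definition lin_isometry_exp (R : realType) (n : nat)
  (m : {measure set borelRn R n -> \bar R}) (mB : {measure set bohrB R n -> \bar R})
  (Lam : set 'rV[R]_n) (W : (borelRn R n -> Cplx R) -> (bohrB R n -> Cplx R)) : Prop :=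
  [/\ (forall f, in_H m Lam f -> L2 mB (W f)),
      (forall (a : Cplx R) f g, in_H m Lam f -> in_H m Lam g ->
         sqnorm mB (fun chi => W (fun x => a * f x + g x) chi - (a * W f chi + W g chi))
           = 0%E),
      (forall f, in_H m Lam f -> sqnorm mB (W f) = sqnorm m f) &
      (forall lam, Lam lam -> sqnorm mB (fun chi => W (expo lam) chi - texpo lam chi) = 0%E)].

(* Main.v *)
(* The Gram matrix of a family of bounded functions determines the L^2 norm of
   every finite linear combination, and by polarization it is recovered from
   those norms. Hence two families indexed by the same set have equal Gram
   matrices exactly when sending one to the other extends to a linear isometry of
   the closed span: W f is the L^2 limit of the images of combinations converging
   to f. The characters of the Bohr group are always orthonormal: for x <> 0 some
   exponential g has g(x) = -1, and invariance of Haar measure under translation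
   by g gives that the integral of chi(x) equals its own opposite. *)
Require Import Defs.
From HB Require Import structures.
From mathcomp Require Import all_boot all_order all_algebra.
From mathcomp Require Import all_classical all_reals all_analysis.
From mathcomp Require Import measurable_realfun complex ring lra.
Import Order.TTheory GRing.Theory Num.Theory.
Import numFieldNormedType.Exports.

Set Implicit Arguments.
Unset Strict Implicit.
Unset Printing Implicit Defensive.

Local Open Scope classical_set_scope.
Local Open Scope ring_scope.

Local Notation Re := (@complex.Re _).
Local Notation Im := (@complex.Im _).

(** [W] acts on representatives, so no quotient space is formed: an equality in L^2 is a vanishing
    [sqnorm], an extended real, and the argument works with squared norms throughout. The triangle
    inequality is replaced by pointwise bounds on [sqmod], the integrand of [sqnorm]. These cost
    constants such as 2, harmless when an error tends to 0 but not when two norms must be shown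
    equal; there a weight tending to 1 is needed. The image of f must be an actual function, which
    dictates the rates: squared errors of order 4^-k leave room for weights 2^k when a pointwise
    limit is extracted. On the Bohr side invariance is known for measurable sets only, so integrals
    are shown to vanish by comparing the distributions of real-valued functions. *)

Definition sqmod (R : realType) (z : Cplx R) : R := Re z ^+ 2 + Im z ^+ 2.

(** * Arithmetic of squared moduli *)

Section CplxArith.
Variable R : realType.
Implicit Types z w : Cplx R.

Lemma Cplx_eqP z w : Re z = Re w -> Im z = Im w -> z = w.
Proof. by case: z w => a b [c d] /= -> ->. Qed.

Lemma CReD z w : Re (z + w) = Re z + Re w.
Proof. by case: z w => a b [c d]. Qed.

Lemma CImD z w : Im (z + w) = Im z + Im w.
Proof. by case: z w => a b [c d]. Qed.

Lemma CReN z : Re (- z) = - Re z.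
Proof. by case: z. Qed.

Lemma CImN z : Im (- z) = - Im z.
Proof. by case: z. Qed.

Lemma CReM z w : Re (z * w) = Re z * Re w - Im z * Im w.
Proof. by case: z w => a b [c d]. Qed.

Lemma CImM z w : Im (z * w) = Re z * Im w + Im z * Re w.
Proof. by case: z w => a b [c d]. Qed.

Lemma CReJ z : Re (conjc z) = Re z.
Proof. by case: z. Qed.

Lemma CImJ z : Im (conjc z) = - Im z.
Proof. by case: z. Qed.

Lemma CRe0 : Re (0 : Cplx R) = 0. Proof. by []. Qed.

Lemma CIm0 : Im (0 : Cplx R) = 0. Proof. by []. Qed.

Lemma CRe1 : Re (1 : Cplx R) = 1. Proof. by []. Qed.

Lemma CIm1 : Im (1 : Cplx R) = 0. Proof. by []. Qed.

Definition CE := (CReD, CImD, CReN, CImN, CReM, CImM, CReJ, CImJ,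
  CRe0, CIm0, CRe1, CIm1).

Lemma sqmod_ge0 z : 0 <= sqmod z.
Proof. by rewrite addr_ge0 ?sqr_ge0. Qed.

Lemma sqmodE z : sqmod z = Re (z * conjc z).
Proof. by rewrite /sqmod !CE; ring. Qed.

Lemma Re2_le_sqmod z : Re z ^+ 2 <= sqmod z.
Proof. by rewrite lerDl sqr_ge0. Qed.

Lemma Im2_le_sqmod z : Im z ^+ 2 <= sqmod z.
Proof. by rewrite lerDr sqr_ge0. Qed.

(** With a = b + c, the cross term 2bc is at most t b^2 + c^2 / t. The free parameter lets the
    weight of b^2 come arbitrarily close to 1. *)
Lemma sqr_young (t a b : R) : 0 < t ->
  a ^+ 2 <= (1 + t) * b ^+ 2 + (1 + t^-1) * (a - b) ^+ 2.
Proof.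
move=> t0; rewrite -subr_ge0.
have -> : (1 + t) * b ^+ 2 + (1 + t^-1) * (a - b) ^+ 2 - a ^+ 2 =
   t^-1 * (t * b - (a - b)) ^+ 2.
  by field; rewrite gt_eqF.
by rewrite mulr_ge0 ?sqr_ge0// invr_ge0 ltW.
Qed.

Lemma sqmod_young (t : R) z w : 0 < t ->
  sqmod z <= (1 + t) * sqmod w + (1 + t^-1) * sqmod (z - w).
Proof.
move=> t0; rewrite /sqmod !CE !mulrDr addrACA.
by rewrite lerD ?sqr_young.
Qed.

(** Parallelogram law for az and w, with the term |az - w|^2 dropped. *)
Lemma sqmod_lin a z w :
  sqmod (a * z + w) <= 2 * sqmod a * sqmod z + 2 * sqmod w.
Proof.
rewrite -subr_ge0.
have -> : 2 * sqmod a * sqmod z + 2 * sqmod w - sqmod (a * z + w) =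
  sqmod (a * z - w) by rewrite /sqmod !CE; ring.
exact: sqmod_ge0.
Qed.

End CplxArith.

(** * Measurability of complex-valued functions *)

Section Cmeasurable.
Context d (X : measurableType d) (R : realType).
Implicit Types f g : X -> Cplx R.

Lemma cmeasurable_lin a f g :
  cmeasurable f -> cmeasurable g -> cmeasurable (fun x => a * f x + g x).
Proof.
move=> [rf jf] [rg jg]; split.
- under eq_fun do rewrite !CE.
  apply: measurable_funD => //.
  by apply: measurable_funB; apply: measurable_funM.
- under eq_fun do rewrite !CE.
  apply: measurable_funD => //.
  by apply: measurable_funD; apply: measurable_funM.
Qed.

Lemma cmeasurable0 : cmeasurable (fun _ : X => 0 : Cplx R).
Proof. by split; exact: measurable_cst. Qed.

Lemma cmeasurableB f g :
  cmeasurable f -> cmeasurable g -> cmeasurable (fun x => f x - g x).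
Proof.
move=> mf mg; have := cmeasurable_lin (-1) mg mf.
by congr cmeasurable; apply/funext => x; rewrite mulN1r addrC.
Qed.

Lemma cmeasurableMJ f g :
  cmeasurable f -> cmeasurable g -> cmeasurable (fun x => f x * conjc (g x)).
Proof.
move=> [rf jf] [rg jg]; split.
- under eq_fun do rewrite !CE.
  apply: measurable_funB; apply: measurable_funM => //.
  exact: measurableT_comp.
- under eq_fun do rewrite !CE.
  apply: measurable_funD; apply: measurable_funM => //.
  exact: measurableT_comp.
Qed.

Lemma measurable_sqmod f : cmeasurable f -> measurable_fun setT (fun x => sqmod (f x)).
Proof. by move=> [rf jf]; apply: measurable_funD; exact: measurable_funX. Qed.

Lemma measurable_esqmod f : cmeasurable f ->
  measurable_fun setT (fun x => (sqmod (f x))%:E).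
Proof. by move=> mf; apply/measurable_EFinP; exact: measurable_sqmod. Qed.

End Cmeasurable.

(** * Inequalities between squared L^2 norms *)

Section Sqnorm.
Context d (X : measurableType d) (R : realType).
Variable m : {measure set X -> \bar R}.
Implicit Types f g : X -> Cplx R.

Lemma sqnorm_ge0 f : (0 <= sqnorm m f)%E.
Proof. by apply: integral_ge0 => x _; rewrite lee_fin sqmod_ge0. Qed.

Lemma sqnorm_le_comb (a b : R) f g h : 0 <= a -> 0 <= b ->
  cmeasurable f -> cmeasurable g -> cmeasurable h ->
  (forall x, sqmod (f x) <= a * sqmod (g x) + b * sqmod (h x)) ->
  (sqnorm m f <= a%:E * sqnorm m g + b%:E * sqnorm m h)%E.
Proof.
move=> a0 b0 mf mg mh fgh.
have sq0 (u : X -> Cplx R) x : setT x -> (0 <= (sqmod (u x))%:E)%E.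
  by rewrite lee_fin sqmod_ge0.
have mf' := measurable_esqmod mf.
have mg' := measurable_esqmod mg.
have mh' := measurable_esqmod mh.
have eZ c (u : X -> Cplx R) : 0 <= c ->
    measurable_fun setT (fun x => (sqmod (u x))%:E) ->
    (c%:E * sqnorm m u = \int[m]_x (c%:E * (sqmod (u x))%:E))%E.
  by move=> c0 mu; rewrite ge0_integralZl_EFin//; exact: sq0.
rewrite !eZ// -ge0_integralD//; last 4 first.
- by move=> x _; rewrite mule_ge0 ?sq0.
- exact: measurable_funeM.
- by move=> x _; rewrite mule_ge0 ?sq0.
- exact: measurable_funeM.
apply: ge0_le_integral => //.
- exact: sq0.
- by apply: emeasurable_funD; exact: measurable_funeM.
- by move=> x _; rewrite lee_fin; exact: fgh.
Qed.

Lemma sqnorm_young (t : R) f g : 0 < t -> cmeasurable f -> cmeasurable g ->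
  (sqnorm m f <= (1 + t)%:E * sqnorm m g +
     (1 + t^-1)%:E * sqnorm m (fun x => f x - g x)%R)%E.
Proof.
move=> t0 mf mg; apply: sqnorm_le_comb => //.
- by rewrite addr_ge0 ?ltW.
- by rewrite addr_ge0 ?invr_ge0 ?ltW.
- exact: cmeasurableB.
- by move=> x; exact: sqmod_young.
Qed.

Lemma sqnorm_lin a f g : cmeasurable f -> cmeasurable g ->
  (sqnorm m (fun x => a * f x + g x)%R <=
     (2 * sqmod a)%:E * sqnorm m f + 2%:E * sqnorm m g)%E.
Proof.
move=> mf mg; apply: sqnorm_le_comb => //.
- by rewrite mulr_ge0 ?sqmod_ge0.
- exact: cmeasurable_lin.
- by move=> x; exact: sqmod_lin.
Qed.

Lemma sqnormC f g : sqnorm m (fun x => f x - g x) = sqnorm m (fun x => g x - f x).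
Proof. by apply: eq_integral => x _; congr EFin; rewrite !CE; ring. Qed.

(** Serves as the triangle inequality through [h], at the price of a factor 2. *)
Lemma sqnormB_le f g h : cmeasurable f -> cmeasurable g -> cmeasurable h ->
  (sqnorm m (fun x => f x - g x)%R <=
     2%:E * sqnorm m (fun x => f x - h x)%R + 2%:E * sqnorm m (fun x => g x - h x)%R)%E.
Proof.
move=> mf mg mh.
have := sqnorm_lin (-1) (cmeasurableB mg mh) (cmeasurableB mf mh).
have -> : 2 * sqmod (-1 : Cplx R) = 2 by rewrite /sqmod !CE; ring.
rewrite addeC; congr (sqnorm m _ <= _)%E.
by apply/funext => x; ring.
Qed.

Lemma L2_lin a f g : L2 m f -> L2 m g -> L2 m (fun x => a * f x + g x).
Proof.
move=> [mf ff] [mg gf]; split; first exact: cmeasurable_lin.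
apply: (le_lt_trans (sqnorm_lin a mf mg)).
by rewrite lte_add_pinfty// lte_mul_pinfty// ?lee_fin ?mulr_ge0 ?sqmod_ge0.
Qed.

End Sqnorm.

(* Young's inequality with [t] tending to [0] takes the place of Minkowski's. *)
Lemma sqnorm_le_approx d (X : measurableType d) d' (Y : measurableType d')
    (R : realType) (m : {measure set X -> \bar R}) (m' : {measure set Y -> \bar R})
    (f : X -> Cplx R) (g : Y -> Cplx R) :
  cmeasurable f -> L2 m' g ->
  (forall eps : R, 0 < eps -> exists p q,
    [/\ cmeasurable p, cmeasurable q,
        (sqnorm m (fun x => f x - p x)%R <= eps%:E)%E,
        (sqnorm m' (fun y => q y - g y)%R <= eps%:E)%E &
        (sqnorm m p <= sqnorm m' q)%E]) ->
  (sqnorm m f <= sqnorm m' g)%E.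
Proof.
move=> mf [mg gfin] H.
have [A EA] : exists A, sqnorm m' g = A%:E.
  by exists (fine (sqnorm m' g)); rewrite fineK// ge0_fin_numE// sqnorm_ge0.
have A0 : 0 <= A by rewrite -lee_fin -EA sqnorm_ge0.
have {}H (t e : R) : 0 < t -> 0 < e ->
    (sqnorm m f <= ((1 + t) * ((1 + t) * A + (1 + t^-1) * e) + (1 + t^-1) * e)%:E)%E.
  move=> t0 e0; have [p [q [mp mq fp qg pq]]] := H e e0.
  have t1 : 0 <= 1 + t by rewrite addr_ge0 ?ltW.
  have t2 : 0 <= 1 + t^-1 by rewrite addr_ge0 ?invr_ge0 ?ltW.
  apply: (le_trans (sqnorm_young m t0 mf mp)).
  rewrite [leRHS]EFinD; apply: leeD; rewrite EFinM; apply: lee_wpmul2l => //.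
  apply: (le_trans pq); apply: (le_trans (sqnorm_young m' t0 mq mg)).
  rewrite EA [leRHS]EFinD; apply: leeD; rewrite EFinM//.
  exact: lee_wpmul2l.
rewrite EA.
(* The instance t = e = 1 already bounds [sqnorm m f] by a real number, which rules out an infinite
   value. *)
have := sqnorm_ge0 m f; have := H 1 1 ltr01 ltr01.
case E : (sqnorm m f) => [N| |]// _ N0; rewrite lee_fin.
rewrite lee_fin in N0.
have {}H (t e : R) : 0 < t -> 0 < e ->
    N <= (1 + t) ^+ 2 * A + (2 + t) * (1 + t^-1) * e.
  move=> t0 e0; have := H t e t0 e0; rewrite E lee_fin.
  by congr (_ <= _); ring.
(* With t fixed, the approximation error is sent to 0; only afterwards does t go to 0. *)
have {}H (t : R) : 0 < t -> N <= (1 + t) ^+ 2 * A.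
  move=> t0; apply/ler_addgt0Pr => e e0.
  have c0 : 0 < (2 + t) * (1 + t^-1) by rewrite mulr_gt0// addr_gt0// invr_gt0.
  have := H t (e / ((2 + t) * (1 + t^-1))) t0 (divr_gt0 e0 c0).
  by rewrite mulrCA mulfV ?gt_eqF// mulr1.
apply/ler_addgt0Pr => e e0.
(* For t <= 1 one has (1 + t)^2 A <= A + 3tA. The denominator 3(A + e + 1) makes 3tA at most e, and
   the summand e in it makes t at most 1. *)
have c0 : 0 < 3 * (A + e + 1) by lra.
pose t := e / (3 * (A + e + 1)).
have t0 : 0 < t by rewrite divr_gt0.
have tE : t * (3 * (A + e + 1)) = e by rewrite /t mulfVK ?gt_eqF.
have t1 : t <= 1 by rewrite ler_pdivrMr//; lra.
apply: (le_trans (H t t0)); rewrite -[X in A + X]tE.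
have : t ^+ 2 * A <= t * A by rewrite ler_wpM2r// expr2 ger_pMl.
have : 0 < t * e by rewrite mulr_gt0.
by rewrite sqrrD expr1n; lra.
Qed.

Section SqnormNull.
Context d (X : measurableType d) (R : realType).
Variable m : {measure set X -> \bar R}.
Implicit Types f g : X -> Cplx R.

Lemma sqnorm0 : sqnorm m (fun=> 0 : Cplx R) = 0%E.
Proof. by apply: integral0_eq => x _; rewrite -/(sqmod _) /sqmod !CE expr0n addr0. Qed.

Lemma sqnorm_subxx f : sqnorm m (fun x => f x - f x) = 0%E.
Proof. by under eq_fun do rewrite subrr; exact: sqnorm0. Qed.

Lemma sqnorm_null_le f g : cmeasurable f -> L2 m g ->
  sqnorm m (fun x => f x - g x) = 0%E -> (sqnorm m f <= sqnorm m g)%E.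
Proof.
move=> mf lg fg0; have [mg _] := lg; apply: sqnorm_le_approx => // eps e0.
by exists g, g; rewrite fg0 sqnorm_subxx lee_fin ltW.
Qed.

Lemma sqnorm_null_eq f g : L2 m f -> L2 m g ->
  sqnorm m (fun x => f x - g x) = 0%E -> sqnorm m f = sqnorm m g.
Proof.
move=> lf lg fg0; apply/eqP; rewrite eq_le !sqnorm_null_le//.
- by case: lg.
- by rewrite sqnormC.
- by case: lf.
Qed.

End SqnormNull.

(** * Complex integrals and Gram matrices *)

Section ComplexIntegral.
Context d (X : measurableType d) (R : realType).
Variable m : {measure set X -> \bar R}.
Implicit Types f g : X -> Cplx R.

Definition cintegrable f : Prop :=
  m.-integrable setT (fun x => (Re (f x))%:E) /\
  m.-integrable setT (fun x => (Im (f x))%:E).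

Definition cint f : Cplx R :=
  (Rintegral m setT (fun x => Re (f x)) +i* Rintegral m setT (fun x => Im (f x)))%C.

Lemma cintegrable0 : cintegrable (fun=> 0).
Proof. by split; exact: integrable0. Qed.

Lemma cint0 : cint (fun=> 0) = 0.
Proof. by apply: Cplx_eqP; rewrite /= /Rintegral integral0. Qed.

Lemma integrable_lin2 (a b : R) (u v w : X -> R) :
  m.-integrable setT (EFin \o u) -> m.-integrable setT (EFin \o v) ->
  m.-integrable setT (EFin \o w) ->
  m.-integrable setT (EFin \o (fun x => a * u x + b * v x + w x)) /\
  Rintegral m setT (fun x => a * u x + b * v x + w x) =
  a * Rintegral m setT u + b * Rintegral m setT v + Rintegral m setT w.
Proof.
move=> iu iv iw.
have iau : m.-integrable setT (EFin \o (fun x => a * u x)).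
  exact: (integrableZl measurableT a iu).
have ibv : m.-integrable setT (EFin \o (fun x => b * v x)).
  exact: (integrableZl measurableT b iv).
have iab : m.-integrable setT (EFin \o (fun x => a * u x + b * v x)).
  exact: (integrableD measurableT iau ibv).
split; first exact: (integrableD measurableT iab iw).
by rewrite !RintegralD// !RintegralZl.
Qed.

Lemma cint_lin a f g : cintegrable f -> cintegrable g ->
  cintegrable (fun x => a * f x + g x) /\
  cint (fun x => a * f x + g x) = a * cint f + cint g.
Proof.
move=> [rf jf] [rg jg].
have [i1 e1] := integrable_lin2 (Re a) (- Im a) rf jf rg.
have [i2 e2] := integrable_lin2 (Re a) (Im a) jf rf jg.
have eR : (fun x => Re (a * f x + g x)) =
    (fun x => Re a * Re (f x) + - Im a * Im (f x) + Re (g x)).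
  by apply/funext => x; rewrite !CE mulNr.
have eI : (fun x => Im (a * f x + g x)) =
    (fun x => Re a * Im (f x) + Im a * Re (f x) + Im (g x)).
  by apply/funext => x; rewrite !CE.
split; first by split; [rewrite -eR in i1; exact: i1|rewrite -eI in i2; exact: i2].
rewrite /cint eR eI e1 e2; apply: Cplx_eqP; rewrite !CE /=; ring.
Qed.

Lemma cint_sum (J : Type) (s : seq J) (a : J -> Cplx R) (F : J -> X -> Cplx R) :
  (forall j, cintegrable (F j)) ->
  cintegrable (fun x => \sum_(j <- s) a j * F j x) /\
  cint (fun x => \sum_(j <- s) a j * F j x) = \sum_(j <- s) a j * cint (F j).
Proof.
move=> iF; elim: s => [|j s [IHi IHe]].
  rewrite big_nil; under eq_fun do rewrite big_nil.
  by split; [exact: cintegrable0|exact: cint0].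
rewrite big_cons -IHe; under eq_fun do rewrite big_cons.
exact: cint_lin.
Qed.

Lemma cintegrable_bounded f : (m setT < +oo)%E -> cmeasurable f ->
  (forall x, sqmod (f x) <= 1) -> cintegrable f.
Proof.
move=> mfin [rf jf] f1.
have bnd (u : X -> R) : measurable_fun setT u -> (forall x, u x ^+ 2 <= 1) ->
    m.-integrable setT (EFin \o u).
  move=> mu u1; apply: measurable_bounded_integrable => //.
  exists 1; split => // M M1 x _ /=.
  apply: (le_trans _ (ltW M1)).
  have := u1 x; rewrite -real_normK ?num_real// => h.
  by rewrite -(@ler_pXn2r _ 2)// ?nnegrE// expr1n.
split; apply: bnd => // x; apply: le_trans (f1 x).
- exact: Re2_le_sqmod.
- exact: Im2_le_sqmod.
Qed.

End ComplexIntegral.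

(** The list may repeat an index, so that a linear combination of two such sums is a concatenation
    of lists. *)
Definition cpoly (R : realType) (I X : Type) (e : I -> X -> Cplx R)
  (s : seq (Cplx R * I)) (x : X) : Cplx R := \sum_(p <- s) p.1 * e p.2 x.

Lemma conjc_sum (R : realType) (J : Type) (s : seq J) (F : J -> Cplx R) :
  conjc (\sum_(j <- s) F j) = \sum_(j <- s) (conjc (F j) : Cplx R) :> Cplx R.
Proof.
elim: s => [|j s IH]; first by rewrite !big_nil; apply: Cplx_eqP; rewrite !CE ?oppr0.
rewrite !big_cons -IH; apply: Cplx_eqP; rewrite !CE//; ring.
Qed.

Lemma conjcM (R : realType) (z w : Cplx R) :
  conjc (z * w) = conjc z * conjc w :> Cplx R.
Proof. by apply: Cplx_eqP; rewrite !CE; ring. Qed.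

Lemma sqmodM (R : realType) (z w : Cplx R) : sqmod (z * w) = sqmod z * sqmod w.
Proof. by rewrite /sqmod !CE; ring. Qed.

Lemma sqmodJ (R : realType) (z : Cplx R) : sqmod (conjc z) = sqmod z.
Proof. by rewrite /sqmod !CE; ring. Qed.

Definition combine (R : realType) (I : Type) (a : Cplx R)
    (s t : seq (Cplx R * I)) : seq (Cplx R * I) :=
  [seq (a * p.1, p.2) | p <- s] ++ t.

Lemma cpoly_combine (R : realType) (I X : Type) (e : I -> X -> Cplx R) a s t x :
  cpoly e (combine a s t) x = a * cpoly e s x + cpoly e t x.
Proof.
rewrite /cpoly big_cat big_map mulr_sumr; congr (_ + _).
by apply: eq_bigr => p _; rewrite mulrA.
Qed.

Section UnimodularFamily.
Context d (X : measurableType d) (R : realType) (I : Type).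
Variables (m : {measure set X -> \bar R}) (e : I -> X -> Cplx R).
Hypothesis mfin : (m setT < +oo)%E.
Hypothesis me : forall i, cmeasurable (e i).
Hypothesis e1 : forall i x, sqmod (e i x) = 1.

Lemma cmeasurable_cpoly s : cmeasurable (cpoly e s).
Proof.
elim: s => [|p s IH]; rewrite /cpoly.
  by under eq_fun do rewrite big_nil; exact: cmeasurable0.
by under eq_fun do rewrite big_cons; exact: cmeasurable_lin.
Qed.

(** Expand the product of the sum with its conjugate and integrate term by term; each product of two
    unimodular functions is bounded, hence integrable for a finite measure. *)
Lemma sqnorm_cpoly s :
  sqnorm m (cpoly e s) = (Re (\sum_(p <- s) \sum_(q <- s)
    p.1 * conjc q.1 * cinner m (e p.2) (e q.2) : Cplx R))%:E.
Proof.
have iE i j : cintegrable m (fun x => e i x * conjc (e j x)).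
  apply: cintegrable_bounded => //; first exact: cmeasurableMJ.
  by move=> x; rewrite sqmodM sqmodJ !e1 mulr1.
have H1 (p : Cplx R * I) := cint_sum s (fun q => p.1 * conjc q.1 : Cplx R)
   (fun q => iE p.2 q.2).
(* The coefficient 1 is there only to give the outer sum the shape expected by [cint_sum]. *)
have [[iR _] E] := cint_sum s (fun=> 1) (fun p => (H1 p).1).
have -> : \sum_(p <- s) \sum_(q <- s)
    p.1 * conjc q.1 * cinner m (e p.2) (e q.2) =
    cint m (fun x => \sum_(p <- s) 1 * (\sum_(q <- s) p.1 * conjc q.1 *
       (e p.2 x * conjc (e q.2 x)) : Cplx R)).
  by rewrite E; apply: eq_bigr => p _; rewrite mul1r (H1 p).2.
rewrite /cint /Rintegral /= fineK; last exact: integrable_fin_num.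
apply: eq_integral => x _; congr EFin.
rewrite -/(sqmod _) sqmodE; congr (Re _).
rewrite conjc_sum mulr_suml; apply: eq_bigr => p _.
rewrite mul1r mulr_sumr; apply: eq_bigr => q _.
by apply: Cplx_eqP; rewrite !CE; ring.
Qed.

Lemma L2_cpoly s : L2 m (cpoly e s).
Proof. by split; [exact: cmeasurable_cpoly|rewrite sqnorm_cpoly ltry]. Qed.

End UnimodularFamily.

(** * Completeness of L^2 *)

Lemma sum_half_pow (R : realType) (n : nat) :
  \sum_(0 <= k < n) (2^-1 : R) ^+ k <= 2.
Proof.
suff -> : \sum_(0 <= k < n) (2^-1 : R) ^+ k = 2 - 2 * 2^-1 ^+ n.
  by rewrite gerBl mulr_ge0 ?exprn_ge0.
elim: n => [|n IH]; first by rewrite big_geq// expr0; lra.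
by rewrite big_nat_recr//= IH exprS; field.
Qed.

(** An increment c satisfies |c| <= 2^-k + 2^k c^2, so the increments are absolutely summable and
    the telescoping series converges. *)
Lemma cvgn_fast (R : realType) (a b : nat -> R) :
  (forall k, (a k.+1 - a k) ^+ 2 <= b k) ->
  (\sum_(k <oo) (2 ^+ k * b k)%:E < +oo)%E -> cvgn a.
Proof.
move=> ab; set S := (\sum_(k <oo) _)%E => Sfin.
have b0 k : 0 <= b k by apply: le_trans (ab k); rewrite sqr_ge0.
have t0 k : (0 <= (2 ^+ k * b k)%:E)%E by rewrite lee_fin mulr_ge0 ?exprn_ge0.
have S0 : (0 <= S)%E by apply: nneseries_ge0.
have SE : S = (fine S)%:E by rewrite fineK// ge0_fin_numE.
have cvs : cvgn (series (telescope a)).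
  apply: (@normed_cvg R R); apply: nondecreasing_is_cvgn.
    by apply: nondecreasing_series => k _ _; exact: normr_ge0.
  exists (2 + fine S) => _ [n _ <-].
  have le1 : \sum_(0 <= k < n) 2 ^+ k * b k <= fine S.
    rewrite -lee_fin -SE -sumEFin; exact: nneseries_lim_ge.
  apply: (@le_trans _ _ (\sum_(0 <= k < n) (2^-1 ^+ k + 2 ^+ k * b k))).
    rewrite /series/=; apply: ler_sum => k _.
    apply: (@le_trans _ _ (2^-1 ^+ k + 2 ^+ k * (a k.+1 - a k) ^+ 2)).
      set c := a k.+1 - a k; rewrite /telescope /=.
      rewrite exprVn; set p := 2 ^+ k.
      have p0 : 0 < p by rewrite exprn_gt0.
      rewrite -/c -(real_normK (num_real c)) -subr_ge0.
      (* Completing the square in |c| shows that the difference is nonnegative. *)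
      have -> : p^-1 + p * `|c| ^+ 2 - `|c| =
          p * ((`|c| - p^-1 / 2) ^+ 2 + 3 / 4 * p^-1 ^+ 2).
        by field; rewrite gt_eqF.
      rewrite mulr_ge0 ?(ltW p0)// addr_ge0 ?sqr_ge0// mulr_ge0 ?sqr_ge0//.
    by rewrite lerD2l ler_wpM2l ?exprn_ge0.
  by rewrite big_split/= lerD// sum_half_pow.
have -> : a = (fun n => a 0%N + series (telescope a) n).
  by apply/funext => n; rewrite -eq_sum_telescope.
by apply: is_cvgD => //; exact: is_cvg_cst.
Qed.

Section RieszFischer.
Context d (X : measurableType d) (R : realType).
Variable m : {measure set X -> \bar R}.

(* Fatou's lemma bounds the distance from [u k] to the pointwise limit. *)
Lemma sqnorm_fast_limit (u : nat -> X -> Cplx R) :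
  (forall k, cmeasurable (u k)) ->
  (forall k l, (k <= l)%N ->
    (sqnorm m (fun x => u l x - u k x)%R <= (4^-1 ^+ k)%:E)%E) ->
  exists g, cmeasurable g /\
    forall k, (sqnorm m (fun x => g x - u k x)%R <= (4^-1 ^+ k)%:E)%E.
Proof.
move=> mu cu.
pose D k x := (sqmod (u k.+1 x - u k x))%:E.
(* The weight 2^k is the one used by [cvgn_fast]. Against squared distances 4^-k it leaves 2^-k, so
   [H] has integral at most 2 and is finite almost everywhere. *)
pose H x := (\sum_(k <oo) ((2 ^+ k)%:E * D k x))%E.
have p0 k : 0 <= (2 : R) ^+ k by rewrite exprn_ge0.
have D0 k x : (0 <= D k x)%E by rewrite lee_fin sqmod_ge0.
have t0 k x : (0 <= (2 ^+ k)%:E * D k x)%E by rewrite mule_ge0.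
have mD k : measurable_fun setT (D k).
  by apply: measurable_esqmod; exact: cmeasurableB.
have mt k : measurable_fun setT (fun x => (2 ^+ k)%:E * D k x)%E.
  exact: measurable_funeM.
have H0 x : (0 <= H x)%E by apply: nneseries_ge0.
have iH : m.-integrable setT H.
  apply/integrableP; split.
    by apply: ge0_emeasurable_sum => // k x _ _; exact: t0.
  under eq_integral do rewrite gee0_abs//.
  rewrite /H integral_nneseries//.
  apply: (@le_lt_trans _ _ 2%:E); last exact: ltry.
  apply: lime_le.
    by apply: is_cvg_nneseries => k _ _; apply: integral_ge0 => x _; exact: t0.
  apply: nearW => n.
  apply: (@le_trans _ _ (\sum_(0 <= k < n) (2^-1 ^+ k)%:E)%E); last first.
    by rewrite sumEFin lee_fin sum_half_pow.
  apply: lee_sum => k _; rewrite ge0_integralZl_EFin//.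
  apply: (@le_trans _ _ ((2 ^+ k)%:E * (4^-1 ^+ k)%:E)%E).
    by apply: lee_wpmul2l; rewrite ?lee_fin//; exact: cu.
  rewrite -EFinM lee_fin -exprMn.
  by have -> : 2 * 4^-1 = 2^-1 :> R by field.
(* An upper limit exists and is measurable everywhere; [fine] turns its infinite values into 0,
   which only matters on the null set where convergence may fail. *)
pose lr x := limn_esup (fun k => (Re (u k x))%:E).
pose li x := limn_esup (fun k => (Im (u k x))%:E).
pose g x : Cplx R := (fine (lr x) +i* fine (li x))%C.
have mg : cmeasurable g.
  split; apply: measurableT_comp; try exact: fine_measurable.
  - apply: measurable_fun_limn_esup => k; apply/measurable_EFinP.
    by have [] := mu k.
  - apply: measurable_fun_limn_esup => k; apply/measurable_EFinP.
    by have [] := mu k.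
exists g; split => // k.
(* The shift by k puts every index in the range where the Cauchy bound against [u k] holds. *)
pose F l x := (sqmod (u (l + k)%N x - u k x))%:E.
have mF l : measurable_fun setT (F l).
  by apply: measurable_esqmod; exact: cmeasurableB.
have F0 l x : setT x -> (0 <= F l x)%E by rewrite lee_fin sqmod_ge0.
(* Where [H] is finite, the sequence converges at x to [g x], so the lower limit of the squared
   distances to [u k x] is the squared distance from [g x]. *)
have -> : sqnorm m (fun x => g x - u k x) = (\int[m]_x limn_einf (F^~ x))%E.
  apply: ge0_ae_eq_integral => //.
  - by apply: measurable_esqmod; exact: cmeasurableB.
  - rewrite /limn_einf; apply: measurableT_comp => //.
    by apply: measurable_fun_limn_esup => l; exact: measurableT_comp.
  - by move=> x _; rewrite lee_fin sqmod_ge0.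
  - move=> x _; rewrite limn_einf_lim; apply: lime_ge; first exact: is_cvg_einfs.
    by apply: nearW => l; apply: le_ereal_inf_tmp => _ [j _ <-]; exact: F0.
  - apply: filterS (integrable_ae measurableT iH) => x /(_ I) Hx _.
    have {}Hx : (H x < +oo)%E by rewrite -ge0_fin_numE.
    have cr : cvgn (fun k => Re (u k x)).
      apply: cvgn_fast Hx => j; rewrite -CReN -CReD; exact: Re2_le_sqmod.
    have ci : cvgn (fun k => Im (u k x)).
      apply: cvgn_fast Hx => j; rewrite -CImN -CImD; exact: Im2_le_sqmod.
    have cE (v : nat -> R) : cvgn v -> v @ \oo --> fine (limn_esup (EFin \o v)).
      move=> cv; have cv' : (EFin \o v) @ \oo --> (limn v)%:E.
        by apply: cvg_EFin => //; exact: nearW.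
      by rewrite (cvg_limn_einf_sup cv').2.
    have {cr} cr := cE _ cr; have {ci} ci := cE _ ci.
    apply/esym; apply: (cvg_limn_einf_sup _).1.
    apply: cvg_EFin; first exact: nearW.
    rewrite /sqmod !CE /=.
    have cs (v : nat -> R) (a : R) : v @ \oo --> a ->
        (fun l => v (l + k)%N) @ \oo --> a by rewrite cvg_shiftn.
    rewrite (_ : fine \o F^~ x = fun l =>
      (Re (u (l + k)%N x) - Re (u k x)) ^+ 2 +
      (Im (u (l + k)%N x) - Im (u k x)) ^+ 2); last first.
      by apply/funext => l /=; rewrite /sqmod !CE.
    have sq (v : nat -> R) (a : R) : v @ \oo --> a ->
      (fun l => v l ^+ 2) @ \oo --> a ^+ 2.
      by move=> va; exact: cvgM.
    apply: cvgD; apply: sq; apply: cvgB; try exact: cvg_cst.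
    + exact: cs cr.
    + exact: cs ci.
apply: (le_trans (fatou _ _ _ _)) => //.
rewrite limn_einf_lim; apply: lime_le; first exact: is_cvg_einfs.
apply: nearW => l; apply: (@le_trans _ _ (\int[m]_x F l x)%E).
  by apply: ereal_inf_lbound; exists l => //=.
by apply: cu; rewrite leq_addl.
Qed.

End RieszFischer.

(** * Isometries and equality of Gram matrices *)

Lemma quarter_pow_lt (R : realType) (C e : R) : 0 <= C -> 0 < e ->
  exists k : nat, C * 4^-1 ^+ k < e.
Proof.
move=> C0 e0; have Ce : 0 <= C / e by rewrite divr_ge0// ltW.
have := archi_boundP Ce; set k := Num.bound _ => Ck; exists k.
have k4 : k%:R < 4 ^+ k :> R by rewrite -natrX ltr_nat ltn_expl.
rewrite exprVn ltr_pdivrMr ?exprn_gt0// mulrC -ltr_pdivrMr//.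
exact: lt_trans k4.
Qed.

Lemma ereal_eq0_quarter (R : realType) (C : R) (N : \bar R) : 0 <= C ->
  (0 <= N)%E -> (forall k, (N <= (C * 4^-1 ^+ k)%:E)%E) -> N = 0%E.
Proof.
move=> C0 N0 NC; apply/eqP; rewrite eq_le N0 andbT.
apply/lee_addgt0Pr => e e0; rewrite add0e.
by have [k ke] := quarter_pow_lt C0 e0; rewrite (le_trans (NC k))// lee_fin ltW.
Qed.

(* [closed_span] and [span_isometry] below are [in_H] and [lin_isometry_exp] for
   arbitrary families; at [expo] and [texpo] they are convertible to them. *)
Section ClosedSpan.
Context d (X : measurableType d) (R : realType) (I : eqType).
Variables (m : {measure set X -> \bar R}) (e : I -> X -> Cplx R) (Lam : set I).

Definition supported (s : seq (Cplx R * I)) : Prop := forall p, p \in s -> Lam p.2.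

Definition closed_span (f : X -> Cplx R) : Prop :=
  L2 m f /\
  forall eps : R, 0 < eps -> exists s, supported s /\
    (sqnorm m (fun x => f x - cpoly e s x)%R < eps%:E)%E.

Lemma supported_combine a s t :
  supported s -> supported t -> supported (combine a s t).
Proof.
move=> hs ht p; rewrite mem_cat => /orP[/mapP[q qs ->]|]; last exact: ht.
exact: hs qs.
Qed.

Lemma supported1 i : Lam i -> supported [:: (1, i)].
Proof. by move=> Li p; rewrite inE => /eqP ->. Qed.

End ClosedSpan.

Lemma cpoly1 (R : realType) (I X : Type) (e : I -> X -> Cplx R) i :
  cpoly e [:: (1, i)] = e i.
Proof. by apply/funext => x; rewrite /cpoly big_seq1 mul1r. Qed.

Lemma gram_single (R : realType) (I : Type) (G : I -> I -> Cplx R) i :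
  \sum_(p <- [:: (1 : Cplx R, i)]) \sum_(q <- [:: (1 : Cplx R, i)])
    p.1 * conjc q.1 * G p.2 q.2 = G i i.
Proof.
rewrite !big_seq1; set g := G _ _.
by apply: Cplx_eqP; rewrite !CE oppr0; ring.
Qed.

Lemma gram_pair (R : realType) (I : Type) (G : I -> I -> Cplx R) (a : Cplx R) i j :
  \sum_(p <- combine a [:: (1, i)] [:: (1, j)])
    \sum_(q <- combine a [:: (1, i)] [:: (1, j)]) p.1 * conjc q.1 * G p.2 q.2 =
  a * conjc a * G i i + a * G i j + conjc a * G j i + G j j.
Proof.
have c1 : conjc (1 : Cplx R) = 1 :> Cplx R by apply: Cplx_eqP; rewrite !CE ?oppr0.
rewrite /combine [[seq _ | _ <- _]]/= mulr1 cat1s.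
rewrite !big_cons !big_nil ![fst _]/= ![snd _]/= c1 !addr0.
by rewrite !mulr1 !mul1r !addrA.
Qed.

(** Once the diagonal terms cancel, the expression reduces to 2 Re (a gij): a = 1 yields the real
    part and a = i the imaginary part. *)
Lemma polarization (R : realType) (gii gij gjj hii hij hjj : Cplx R) :
  Re gii = Re hii -> Re gjj = Re hjj ->
  (forall a : Cplx R,
    Re (a * conjc a * gii + a * gij + conjc a * conjc gij + gjj) =
    Re (a * conjc a * hii + a * hij + conjc a * conjc hij + hjj)) ->
  gij = hij.
Proof.
case: gii gij gjj hii hij hjj => [g1 g2] [g3 g4] [g5 g6] [h1 h2] [h3 h4] [h5 h6].
move=> /= eii ejj H; have := H 1; have := H (0 +i* 1)%C.
rewrite /= => Hi H1.
by apply: Cplx_eqP => /=; lra.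
Qed.

(** * Linear structure of the closed span and norms of two-term combinations *)

Section ClosedSpanTheory.
Context d (X : measurableType d) (R : realType) (I : eqType).
Variables (m : {measure set X -> \bar R}) (e : I -> X -> Cplx R) (Lam : set I).
Hypothesis mfin : (m setT < +oo)%E.
Hypothesis me : forall i, cmeasurable (e i).
Hypothesis e1 : forall i x, sqmod (e i x) = 1.

Lemma closed_span_cpoly s : supported Lam s -> closed_span m e Lam (cpoly e s).
Proof.
move=> hs; split; first exact: L2_cpoly.
by move=> eps e0; exists s; rewrite sqnorm_subxx lte_fin.
Qed.

Lemma closed_span_gen i : Lam i -> closed_span m e Lam (e i).
Proof. by move=> Li; rewrite -(cpoly1 e); apply: closed_span_cpoly; exact: supported1. Qed.

Lemma closed_span_lin a f g : closed_span m e Lam f -> closed_span m e Lam g ->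
  closed_span m e Lam (fun x => a * f x + g x).
Proof.
move=> [lf af] [lg ag]; split; first exact: L2_lin.
move=> eps e0; have A0 := sqmod_ge0 a.
(* [sqnorm_lin] gives an error of at most (2|a|^2 + 2) del; the 3 in place of 2 makes the final
   inequality strict. *)
have c0 : 0 < 2 * sqmod a + 3 by lra.
pose del := eps / (2 * sqmod a + 3).
have d0 : 0 < del by rewrite divr_gt0.
have [s [hs fs]] := af del d0; have [t [ht gt]] := ag del d0.
exists (combine a s t); split; first exact: supported_combine.
under eq_fun do rewrite cpoly_combine.
have -> : (fun x => a * f x + g x - (a * cpoly e s x + cpoly e t x)) =
  (fun x => a * (f x - cpoly e s x) + (g x - cpoly e t x)).
  by apply/funext => x; ring.
have mp := cmeasurable_cpoly me.
apply: (le_lt_trans (sqnorm_lin _ _ (cmeasurableB lf.1 (mp s)) (cmeasurableB lg.1 (mp t)))).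
apply: (@le_lt_trans _ _ ((2 * sqmod a)%:E * del%:E + 2%:E * del%:E)%E).
  by apply: leeD; apply: lee_wpmul2l; rewrite ?lee_fin ?mulr_ge0//; exact: ltW.
rewrite -!EFinM -EFinD lte_fin.
have <- : del * (2 * sqmod a + 3) = eps by rewrite /del mulfVK ?gt_eqF.
nra.
Qed.

Lemma cinnerC i j : cinner m (e j) (e i) = conjc (cinner m (e i) (e j)).
Proof.
have iE k l : cintegrable m (fun x => e k x * conjc (e l x)).
  apply: cintegrable_bounded => //; first exact: cmeasurableMJ.
  by move=> x; rewrite sqmodM sqmodJ !e1 mulr1.
apply: Cplx_eqP => /=.
  by apply: eq_Rintegral => x _; rewrite !CE; ring.
rewrite -mulN1r -RintegralZl//; last exact: (iE i j).2.
by apply: eq_Rintegral => x _; rewrite !CE; ring.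
Qed.

Lemma sqnorm_gen i : sqnorm m (e i) = (Re (cinner m (e i) (e i)))%:E.
Proof.
rewrite -[in LHS](cpoly1 e) sqnorm_cpoly//; congr (Re _)%:E.
exact: (gram_single (fun u v => cinner m (e u) (e v))).
Qed.

Lemma sqnorm_pair a i j : sqnorm m (fun x => a * e i x + e j x) =
  (Re (a * conjc a * cinner m (e i) (e i) + a * cinner m (e i) (e j)
   + conjc a * conjc (cinner m (e i) (e j)) + cinner m (e j) (e j) : Cplx R))%:E.
Proof.
rewrite (_ : (fun x => _) = cpoly e (combine a [:: (1, i)] [:: (1, j)])).
  rewrite sqnorm_cpoly//; congr (Re _)%:E; rewrite -(cinnerC i j).
  exact: (gram_pair (fun u v => cinner m (e u) (e v))).
by apply/funext => x; rewrite cpoly_combine !cpoly1.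
Qed.

End ClosedSpanTheory.

Definition span_isometry d (X : measurableType d) d' (Y : measurableType d')
  (R : realType) (I : eqType)
  (m : {measure set X -> \bar R}) (e : I -> X -> Cplx R)
  (m' : {measure set Y -> \bar R}) (e' : I -> Y -> Cplx R)
  (Lam : set I) (W : (X -> Cplx R) -> (Y -> Cplx R)) : Prop :=
  [/\ (forall f, closed_span m e Lam f -> L2 m' (W f)),
      (forall (a : Cplx R) f g, closed_span m e Lam f -> closed_span m e Lam g ->
         sqnorm m' (fun y => W (fun x => a * f x + g x) y - (a * W f y + W g y))
           = 0%E),
      (forall f, closed_span m e Lam f -> sqnorm m' (W f) = sqnorm m f) &
      (forall i, Lam i -> sqnorm m' (fun y => W (e i) y - e' i y) = 0%E)].

(** * Equal Gram matrices versus isometries *)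

Section GramIsometry.
Context d (X : measurableType d) d' (Y : measurableType d') (R : realType) (I : eqType).
Variables (m : {measure set X -> \bar R}) (e : I -> X -> Cplx R).
Variables (m' : {measure set Y -> \bar R}) (e' : I -> Y -> Cplx R).
Variable Lam : set I.
Hypothesis mfin : (m setT < +oo)%E.
Hypothesis mfin' : (m' setT < +oo)%E.
Hypothesis me : forall i, cmeasurable (e i).
Hypothesis me' : forall i, cmeasurable (e' i).
Hypothesis e1 : forall i x, sqmod (e i x) = 1.
Hypothesis e1' : forall i y, sqmod (e' i y) = 1.

Lemma gram_of_isometry W : span_isometry m e m' e' Lam W ->
  forall i j, Lam i -> Lam j -> cinner m (e i) (e j) = cinner m' (e' i) (e' j).
Proof.
move=> [WL Wlin Wiso We] i j Li Lj.
have Ci := closed_span_gen mfin me e1 Li.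
have Cj := closed_span_gen mfin me e1 Lj.
have L2e' k : L2 m' (e' k) by rewrite -(cpoly1 e'); exact: L2_cpoly.
have Nk k : Lam k -> Re (cinner m (e k) (e k)) = Re (cinner m' (e' k) (e' k)).
  move=> Lk; have Ck := closed_span_gen mfin me e1 Lk.
  have := Wiso _ Ck; rewrite (sqnorm_null_eq (WL _ Ck) (L2e' k) (We k Lk)).
  by rewrite !sqnorm_gen// => -[].
(* [W] sends the combination to a W(e i) + W(e j), and then to the same combination of [e' i] and
   [e' j], each time up to a null difference. *)
have N a : sqnorm m (fun x => a * e i x + e j x) =
    sqnorm m' (fun y => a * e' i y + e' j y).
  rewrite -Wiso; last exact: closed_span_lin.
  rewrite (sqnorm_null_eq _ _ (Wlin a _ _ Ci Cj)); last 2 first.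
  - by apply: WL; exact: closed_span_lin.
  - by apply: L2_lin; exact: WL.
  apply: sqnorm_null_eq; try (by apply: L2_lin; auto).
  have -> : (fun y => a * W (e i) y + W (e j) y - (a * e' i y + e' j y)) =
     (fun y => a * (W (e i) y - e' i y) + (W (e j) y - e' j y)).
    by apply/funext => y; ring.
  apply/eqP; rewrite eq_le sqnorm_ge0 andbT.
  have mB k : Lam k -> cmeasurable (fun y => W (e k) y - e' k y).
    move=> Lk; apply: cmeasurableB => //; apply: (WL _ _).1.
    exact: closed_span_gen.
  by have := sqnorm_lin m' a (mB i Li) (mB j Lj); rewrite !We// !mule0 adde0.
apply: polarization (Nk i Li) (Nk j Lj) _ => a.
by have := N a; rewrite !sqnorm_pair// => -[].
Qed.

Hypothesis gram : forall i j, Lam i -> Lam j ->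
  cinner m (e i) (e j) = cinner m' (e' i) (e' j).

Lemma sqnorm_cpoly_gram s : supported Lam s ->
  sqnorm m (cpoly e s) = sqnorm m' (cpoly e' s).
Proof.
move=> hs; rewrite !sqnorm_cpoly//; congr (Re _)%:E.
rewrite big_seq [RHS]big_seq; apply: eq_bigr => p ps.
rewrite big_seq [RHS]big_seq; apply: eq_bigr => q qs.
by rewrite gram//; exact: hs.
Qed.

Lemma sqnormB_cpoly_gram s t : supported Lam s -> supported Lam t ->
  sqnorm m (fun x => cpoly e s x - cpoly e t x) =
  sqnorm m' (fun y => cpoly e' s y - cpoly e' t y).
Proof.
move=> hs ht.
have E Z (u : I -> Z -> Cplx R) : (fun x => cpoly u s x - cpoly u t x) =
    cpoly u (combine (-1) t s).
  by apply/funext => x; rewrite cpoly_combine; ring.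
by rewrite !E; apply: sqnorm_cpoly_gram; exact: supported_combine.
Qed.

(* [W f] is an L^2-limit of the images of polynomials converging fast to [f]. *)
Lemma isometry_of_gram : exists W, span_isometry m e m' e' Lam W.
Proof.
(* The extra factor 1/4 absorbs the constants of [sqnormB_le]: for k <= l, the sum of 2/4 times 4^-l
   and 2/4 times 4^-k is at most 4^-k, the rate wanted by [sqnorm_fast_limit]. *)
have [S HS] : exists S : (X -> Cplx R) -> nat -> seq (Cplx R * I),
    forall f, closed_span m e Lam f -> forall k, supported Lam (S f k) /\
      (sqnorm m (fun x => f x - cpoly e (S f k) x)%R <= (4^-1 * 4^-1 ^+ k)%:E)%E.
  (* Choice ranges over all functions, with a dummy value outside the closed span. *)
  suff /choice[S HS] : forall f, exists s : nat -> seq (Cplx R * I),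
      closed_span m e Lam f -> forall k, supported Lam (s k) /\
      (sqnorm m (fun x => f x - cpoly e (s k) x)%R <= (4^-1 * 4^-1 ^+ k)%:E)%E.
    by exists S.
  move=> f; have [[_ af]|nf] := pselect (closed_span m e Lam f); last first.
    by exists (fun=> [::]).
  have /choice[s hs] : forall k, exists s, supported Lam s /\
      (sqnorm m (fun x => f x - cpoly e s x)%R <= (4^-1 * 4^-1 ^+ k)%:E)%E.
    move=> k; have [|s [hs fs]] := af (4^-1 * 4^-1 ^+ k).
      by rewrite mulr_gt0 ?exprn_gt0.
    by exists s; split => //; exact: ltW.
  by exists s.
have q0 k : 0 < (4^-1 : R) ^+ k by rewrite exprn_gt0.
have mp := cmeasurable_cpoly me; have mp' := cmeasurable_cpoly me'.
have HS4 f k : closed_span m e Lam f ->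
    (sqnorm m (fun x => f x - cpoly e (S f k) x)%R <= (4^-1 ^+ k)%:E)%E.
  move=> cf; apply: (le_trans (HS f cf k).2); rewrite lee_fin.
  by have := q0 k; lra.
have /choice[W HW] : forall f, exists g, closed_span m e Lam f -> cmeasurable g /\
    forall k, (sqnorm m' (fun y => g y - cpoly e' (S f k) y)%R <= (4^-1 ^+ k)%:E)%E.
  move=> f; have [cf|nf] := pselect (closed_span m e Lam f); last by exists (fun=> 0).
  have mf := cf.1.1.
  have [||g gP] := @sqnorm_fast_limit _ _ _ m' (fun k => cpoly e' (S f k)).
  - by move=> k; exact: mp'.
  - move=> k l kl.
    have [hk fk] := HS f cf k; have [hl fl] := HS f cf l.
    rewrite -sqnormB_cpoly_gram//.
    apply: (le_trans (sqnormB_le m (mp _) (mp _) mf)).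
    rewrite sqnormC [X in (_ + _ * X)%E]sqnormC.
    apply: (@le_trans _ _ (2%:E * (4^-1 * 4^-1 ^+ l)%:E + 2%:E * (4^-1 * 4^-1 ^+ k)%:E)%E).
      by apply: leeD; apply: lee_wpmul2l; rewrite ?lee_fin.
    rewrite -!EFinM -EFinD lee_fin.
    have : (4^-1 : R) ^+ l <= 4^-1 ^+ k.
      by apply: ler_wiXn2l => //; rewrite invf_le1// ler1n.
    lra.
  - by exists g.
have mW f : closed_span m e Lam f -> cmeasurable (W f) by move=> /HW[].
have HWk f k cf := (HW f cf).2 k.
have WL f : closed_span m e Lam f -> L2 m' (W f).
  move=> cf; split; first exact: mW.
  apply: (le_lt_trans (sqnorm_young m' ltr01 (mW f cf) (mp' (S f 0%N)))).
  have := HWk f 0%N cf; set n1 := sqnorm m' (fun _ => _) => h.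
  have n1fin : (n1 < +oo)%E by apply: le_lt_trans h (ltry _).
  have [_ n2fin] := L2_cpoly mfin' me' e1' (S f 0%N).
  by apply: lte_add_pinfty; apply: lte_mul_pinfty; rewrite // lee_fin addr_ge0 ?invr_ge0.
have kl (eps : R) : 0 < eps -> exists k : nat, (4^-1 : R) ^+ k <= eps.
  move=> e0; have [k] := quarter_pow_lt ler01 e0.
  by rewrite mul1r => h; exists k; exact: ltW.
exists W; split => //.
- move=> a f g cf cg; have ch := closed_span_lin me a cf cg.
  set h := fun x => a * f x + g x in ch *.
  have A0 := sqmod_ge0 a.
  pose B := 2 * sqmod a + 2.
  have B0 : 0 <= B by rewrite /B; lra.
  (* The constant comes from nested uses of [sqnormB_le]. [W h] is within 1 (in units of 4^-k) of
     the image of the polynomial for h, and a W f + W g is within B of the image of [t]. These two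
     images are within 2 + 2B of each other, since their distance equals that of the original
     polynomials, both close to h. *)
  apply: (@ereal_eq0_quarter _ (2 + 2 * (2 * B + 2 * (2 + 2 * B)))).
  + lra.
  + exact: sqnorm_ge0.
  move=> k; have hq := q0 k.
  have [hf _] := HS f cf k; have [hg _] := HS g cg k; have [hh _] := HS h ch k.
  have [mf mg mh] := And3 cf.1.1 cg.1.1 ch.1.1.
  set t := combine a (S f k) (S g k).
  have ht : supported Lam t by exact: supported_combine.
  (* Stated over an arbitrary measure space because it serves on both sides: for f and g, and for
     their images. *)
  have comb d0 (Z : measurableType d0) (mm : {measure set Z -> \bar R})
      (u : I -> Z -> Cplx R) (v w : Z -> Cplx R) :
      (forall s, cmeasurable (cpoly u s)) -> cmeasurable v -> cmeasurable w ->
      (sqnorm mm (fun x => v x - cpoly u (S f k) x)%R <= (4^-1 ^+ k)%:E)%E ->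
      (sqnorm mm (fun x => w x - cpoly u (S g k) x)%R <= (4^-1 ^+ k)%:E)%E ->
      (sqnorm mm (fun x => a * v x + w x - cpoly u t x)%R <= (B * 4^-1 ^+ k)%:E)%E.
    move=> mu mv mw hv hw.
    have -> : (fun x => a * v x + w x - cpoly u t x) =
       (fun x => a * (v x - cpoly u (S f k) x) + (w x - cpoly u (S g k) x)).
      by apply/funext => x; rewrite cpoly_combine; ring.
    apply: (le_trans (sqnorm_lin mm a (cmeasurableB mv (mu _)) (cmeasurableB mw (mu _)))).
    rewrite /B [(_ + 2) * _]mulrDl [leRHS]EFinD; apply: leeD; rewrite [leRHS]EFinM; apply: lee_wpmul2l => //.
    by rewrite lee_fin; lra.
  have m1 : cmeasurable (fun y => a * W f y + W g y).
    by apply: cmeasurable_lin; exact: mW.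
  have k1 := HWk h k ch.
  have k2 := comb _ _ _ _ _ _ mp' (mW f cf) (mW g cg) (HWk f k cf) (HWk g k cg).
  have k3 := comb _ _ _ _ _ _ mp mf mg (HS4 f k cf) (HS4 g k cg).
  have k4 : (sqnorm m' (fun y => cpoly e' (S h k) y - cpoly e' t y)%R <=
      ((2 + 2 * B) * 4^-1 ^+ k)%:E)%E.
    rewrite -sqnormB_cpoly_gram//.
    apply: (le_trans (sqnormB_le m (mp _) (mp _) mh)).
    rewrite sqnormC [X in (_ + _ * X)%E]sqnormC.
    rewrite [(_ + _) * 4^-1 ^+ k]mulrDl -mulrA [leRHS]EFinD; apply: leeD; rewrite [leRHS]EFinM; apply: lee_wpmul2l => //.
    exact: HS4.
  apply: (le_trans (sqnormB_le m' (mW h ch) m1 (mp' (S h k)))).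
  rewrite [(_ + _) * 4^-1 ^+ k]mulrDl -mulrA [leRHS]EFinD; apply: leeD; rewrite [leRHS]EFinM; apply: lee_wpmul2l => //.
  apply: (le_trans (sqnormB_le m' m1 (mp' (S h k)) (mp' t))).
  rewrite [(_ + _) * 4^-1 ^+ k]mulrDl -!mulrA [leRHS]EFinD; apply: leeD; rewrite [leRHS]EFinM; apply: lee_wpmul2l => //.
(* The two inequalities are the same approximation argument with source and target exchanged, since
   the approximating polynomials have equal norms on both sides. *)
- move=> f cf; have mf := cf.1.1; apply/eqP; rewrite eq_le; apply/andP; split.
  + apply: sqnorm_le_approx; [exact: mW|exact: cf.1|] => eps /kl[k ke].
    exists (cpoly e' (S f k)), (cpoly e (S f k)); split => //.
    * by apply: (le_trans (HWk f k cf)); rewrite lee_fin.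
    * by rewrite sqnormC (le_trans (HS4 f k cf))// lee_fin.
    * by rewrite sqnorm_cpoly_gram//; exact: (HS f cf k).1.
  + apply: sqnorm_le_approx; [exact: mf|exact: WL|] => eps /kl[k ke].
    exists (cpoly e (S f k)), (cpoly e' (S f k)); split => //.
    * by apply: (le_trans (HS4 f k cf)); rewrite lee_fin.
    * by rewrite sqnormC (le_trans (HWk f k cf))// lee_fin.
    * by rewrite sqnorm_cpoly_gram//; exact: (HS f cf k).1.
- move=> i Li; have ci := closed_span_gen mfin me e1 Li.
  apply: (@ereal_eq0_quarter _ (2 + 2)) => [||k].
    by rewrite addr_ge0.
    exact: sqnorm_ge0.
  apply: (le_trans (sqnormB_le m' (mW _ ci) (me' i) (mp' (S (e i) k)))).
  rewrite [(_ + _) * 4^-1 ^+ k]mulrDl [leRHS]EFinD; apply: leeD; rewrite [leRHS]EFinM; apply: lee_wpmul2l => //.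
    exact: HWk.
  (* The generator is itself a one-term polynomial, so its distance to the approximating polynomial
     can be carried back to the source. *)
  rewrite -(cpoly1 e') -sqnormB_cpoly_gram ?cpoly1.
  + exact: HS4.
  + exact: supported1.
  + exact: (HS _ ci k).1.
Qed.

End GramIsometry.

(** * Exponentials and characters of the Bohr group *)

(** The integral is the first moment of the law of [w], and the hypothesis says that [w] and its
    opposite have the same law. *)
Lemma Rintegral_symmetric d (X : measurableType d) (R : realType)
    (m : {measure set X -> \bar R}) (w : X -> R) :
  m.-integrable setT (EFin \o w) ->
  (forall B, measurable B -> m (w @^-1` B) = m ((fun x => - w x) @^-1` B)) ->
  Rintegral m setT w = 0.
Proof.
move=> iw sym.
have mw : measurable_fun setT w by apply/measurable_EFinP; exact: measurable_int iw.
have mNw : measurable_fun setT (fun x => - w x) by exact: measurableT_comp.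
have iNw : m.-integrable setT (EFin \o (fun x => - w x)).
  by have := integrableN iw; apply: eq_integrable.
have eN : Rintegral m setT (fun x => - w x) = - Rintegral m setT w.
  rewrite -mulN1r -RintegralZl//.
  by apply: eq_Rintegral => x _; rewrite mulN1r.
suff : Rintegral m setT w = Rintegral m setT (fun x => - w x) by rewrite eN; lra.
have push v : measurable_fun setT v -> m.-integrable setT (EFin \o v) ->
    (\int[m]_x (v x)%:E = \int[pushforward m v]_y y%:E)%E.
  move=> mv iv; apply/esym.
  exact: (@integral_pushforward _ _ _ _ _ v mv m setT EFin).
rewrite /Rintegral; congr fine; rewrite !push//.
by apply: eq_measure_integral => B mB _; exact: sym.
Qed.

Lemma continuous_borel (R : realType) (T : ptopologicalType) (u : T -> R) :
  continuous u -> measurable_fun setT (u : g_sigma_algebraType (@open T) -> R).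
Proof.
move=> /continuousP cu; apply: (measurability _ (RGenOpens.measurableE R)).
move=> _ [_ [a [b ->] <-]]; rewrite setTI.
by apply: sub_sigma_algebra; apply: cu; exact: interval_open.
Qed.

(** * Continuity of real and imaginary parts *)

Section CplxContinuity.
Variable R : realType.

Lemma norm1_sqmod (z : Cplx R) : `|z| = 1 <-> sqmod z = 1.
Proof.
split=> [z1|z1].
  have := add_Re2_Im2 z; rewrite -/(sqmod z).
  have -> : `|z : R[i]| ^+ 2 = 1%:C%C by move: z1; rewrite /= => ->; rewrite expr1n.
  by case.
by have := normc_def z; rewrite -/(sqmod z) z1 sqrtr1.
Qed.

Lemma norm_Re_lt (z : Cplx R) (e : R) : `|z| < (e +i* 0)%C :> Cplx R -> `|Re z| < e.
Proof.
have -> : `|z| = (Num.sqrt (sqmod z) +i* 0)%C by exact: normc_def.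
rewrite ltcR; apply: le_lt_trans.
by rewrite -sqrtr_sqr ler_wsqrtr// Re2_le_sqmod.
Qed.

Lemma norm_Im_lt (z : Cplx R) (e : R) : `|z| < (e +i* 0)%C :> Cplx R -> `|Im z| < e.
Proof.
have -> : `|z| = (Num.sqrt (sqmod z) +i* 0)%C by exact: normc_def.
rewrite ltcR; apply: le_lt_trans.
by rewrite -sqrtr_sqr ler_wsqrtr// Im2_le_sqmod.
Qed.

Lemma continuous_CRe : continuous (fun z : Cplx R => Re z : R).
Proof.
move=> z; apply/(@cvgrPdist_lt _ _ _ _ (nbhs_filter z)) => e e0.
have e0' : 0 < (e +i* 0)%C :> Cplx R by rewrite ltcR.
have : \forall w \near z, `|z - w| < ((e +i* 0)%C : Cplx R).
  by apply/nbhs_normP; exists (e +i* 0)%C.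
by apply: filterS => w zw; rewrite -CReN -CReD; exact: norm_Re_lt.
Qed.

Lemma continuous_CIm : continuous (fun z : Cplx R => Im z : R).
Proof.
move=> z; apply/(@cvgrPdist_lt _ _ _ _ (nbhs_filter z)) => e e0.
have e0' : 0 < (e +i* 0)%C :> Cplx R by rewrite ltcR.
have : \forall w \near z, `|z - w| < ((e +i* 0)%C : Cplx R).
  by apply/nbhs_normP; exists (e +i* 0)%C.
by apply: filterS => w zw; rewrite -CImN -CImD; exact: norm_Im_lt.
Qed.

End CplxContinuity.

(** * Exponentials on R^n *)

Section Exponentials.
Context (R : realType) (n : nat).
Implicit Types lam x y : 'rV[R]_n.

Lemma sqmod_cexpi (t : R) : sqmod (cexpi t) = 1.
Proof. exact: cos2Dsin2. Qed.

Lemma cexpiD (s t : R) : cexpi (s + t) = cexpi s * cexpi t.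
Proof. by apply: Cplx_eqP; rewrite !CE /= ?cosD ?sinD; ring. Qed.

Lemma dotRD lam x y : dotR lam (x + y) = dotR lam x + dotR lam y.
Proof.
by rewrite /dotR -big_split; apply: eq_bigr => i _ /=; rewrite mxE mulrDr.
Qed.

Lemma dotRZ lam (c : R) x : dotR (c *: lam) x = c * dotR lam x.
Proof.
by rewrite /dotR mulr_sumr; apply: eq_bigr => i _ /=; rewrite mxE mulrA.
Qed.

Lemma dotR_gt0 x : x != 0 -> 0 < dotR x x.
Proof.
move=> x0; rewrite lt0r sumr_ge0 ?andbT; last by move=> i _; rewrite -expr2 sqr_ge0.
apply: contra x0; rewrite psumr_eq0; last by move=> i _; rewrite -expr2 sqr_ge0.
move=> /allP H; apply/eqP/rowP => i; rewrite mxE.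
by have := H i (mem_index_enum _); rewrite -expr2 sqrf_eq0 => /eqP.
Qed.

Lemma expo_is_char lam : is_char (expo lam).
Proof.
split=> [x|x y]; first by apply/norm1_sqmod; exact: sqmod_cexpi.
by rewrite /expo dotRD mulrDr cexpiD.
Qed.

Lemma continuous_dotR lam : continuous (dotR lam).
Proof.
apply: continuous_big => [|i _ x]; first exact: add_continuous.
exact: (cvgM (cvg_cst (lam ord0 i)) (@coord_continuous R _ _ ord0 i x)).
Qed.

Lemma cmeasurable_expo lam : cmeasurable (expo lam : borelRn R n -> Cplx R).
Proof.
have ca : continuous (fun x => 2 * pi * dotR lam x : R).
  by move=> x; exact: cvgMl_tmp (@continuous_dotR lam x).
split; apply: continuous_borel => x.
- by apply: (@continuous_comp _ _ _ (fun x => 2 * pi * dotR lam x) cos);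
    [exact: ca|exact: continuous_cos].
- by apply: (@continuous_comp _ _ _ (fun x => 2 * pi * dotR lam x) sin);
    [exact: ca|exact: continuous_sin].
Qed.

Lemma separating_char x : x != 0 -> exists lam, expo lam x = -1.
Proof.
(* Scaling x by 1 / (2 |x|^2) makes the inner product with x equal to 1/2, hence the phase equal to
   pi. *)
move=> /dotR_gt0 x0; exists ((2 * dotR x x)^-1 *: x).
have E : 2 * pi * dotR ((2 * dotR x x)^-1 *: x) x = pi.
  by rewrite dotRZ; field; rewrite gt_eqF.
by rewrite /expo E; apply: Cplx_eqP; rewrite /= ?cospi ?sinpi ?oppr0.
Qed.

End Exponentials.

(** * Characters of the Bohr group *)

Section Bohr.
Context (R : realType) (n : nat).
Implicit Types (chi : bohr R n) (x y : 'rV[R]_n).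

Lemma bohr_char chi : is_char (sval chi).
Proof. by case: chi => chi p; exact: set_mem p. Qed.

Lemma sqmod_bohr chi x : sqmod (sval chi x) = 1.
Proof. by apply/norm1_sqmod; exact: (bohr_char chi).1. Qed.

Lemma continuous_bohr_eval x : continuous (fun chi : bohr R n => sval chi x).
Proof.
move=> chi.
apply: (@continuous_comp _ _ _ (set_val : bohr R n -> {ptws 'rV[R]_n -> Cplx R})
  (fun f => f x)); first exact: initial_continuous.
exact: proj_continuous.
Qed.

Lemma cmeasurable_texpo x : cmeasurable (texpo x : bohrB R n -> Cplx R).
Proof.
split; apply: continuous_borel => chi.
- apply: (@continuous_comp _ _ _ (fun chi : bohr R n => sval chi x)
    (fun z : Cplx R => Re z : R)); first exact: continuous_bohr_eval.
  exact: continuous_CRe.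
- apply: (@continuous_comp _ _ _ (fun chi : bohr R n => sval chi x)
    (fun z : Cplx R => Im z : R)); first exact: continuous_bohr_eval.
  exact: continuous_CIm.
Qed.

(** Translation by [g] is onto: on the unit circle the conjugate of [g] is its inverse. *)
Lemma bohr_divide (g h : bohr R n) :
  exists a : bohr R n, forall x, sval h x = sval g x * sval a x.
Proof.
have [gn gm] := bohr_char g; have [hn hm] := bohr_char h.
have Ha : (fun x => conjc (sval g x) * sval h x : Cplx R) \in @bohr_set R n.
  rewrite inE; split=> [x|x y].
    by apply/norm1_sqmod; rewrite sqmodM sqmodJ !sqmod_bohr mulr1.
  by rewrite gm hm conjcM mulrACA.
exists (exist (fun f => f \in @bohr_set R n) _ Ha : bohr R n) => x /=.
have gg : sval g x * conjc (sval g x) = 1.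
  apply: Cplx_eqP; last by rewrite !CE; ring.
  by rewrite -sqmodE sqmod_bohr.
by rewrite mulrA gg mul1r.
Qed.

(* The character [g] with [g x = -1] makes the law of any real-linear
   functional of [chi x] symmetric; this avoids continuity of translations. *)
Lemma bohr_integral0 (muB : probability (bohrB R n) R) (haar : is_haar muB) x
    (L : Cplx R -> R) :
  x != 0 -> (forall z, L (- z) = - L z) ->
  muB.-integrable setT (EFin \o (fun chi : bohrB R n => L (texpo x chi))) ->
  Rintegral muB setT (fun chi : bohrB R n => L (texpo x chi)) = 0.
Proof.
move=> x0 LN iL; apply: Rintegral_symmetric => // B mB.
have [lam lamx] := separating_char x0.
have Hg : expo lam \in @bohr_set R n by rewrite inE; exact: expo_is_char.
pose g : bohr R n := exist (fun f => f \in @bohr_set R n) _ Hg.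
have mL : measurable ((fun chi : bohrB R n => L (texpo x chi)) @^-1` B).
  have mf : measurable_fun setT (fun chi : bohrB R n => L (texpo x chi)).
    by apply/measurable_EFinP; exact: measurable_int iL.
  by rewrite -[X in measurable X]setTI; exact: mf.
(* If h = g a pointwise, then h(x) = -a(x). Translation by [g] thus carries the set where L(chi(x))
   lies in B onto the set where -L(chi(x)) does. *)
apply: (etrans (esym (haar.1 g _ mL))); congr (muB _).
apply/seteqP; split=> [h [a Ba hE]|h Bh] /=.
  by rewrite /texpo hE /= lamx mulN1r LN opprK.
have [a hE] := bohr_divide g h; exists a => //=.
by move: Bh; rewrite /= /texpo hE /= lamx mulN1r LN opprK.
Qed.

(** The product of chi(x) with the conjugate of chi(y) is chi(x - y): constantly 1 on the diagonal,
    of zero integral off it. *)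
Lemma texpo_orthonormal (muB : probability (bohrB R n) R) (haar : is_haar muB) x y :
  cinner muB (texpo x) (texpo y) = if x == y then 1 else 0.
Proof.
have m1 : muB setT = 1%E by exact: probability_setT.
case: eqVneq => [->|xy].
  apply: Cplx_eqP; rewrite /cinner /=.
    under eq_Rintegral do rewrite -sqmodE sqmod_bohr.
    by rewrite Rintegral_cst// mul1r; exact: (congr1 fine m1).
  under eq_Rintegral => chi _.
    rewrite (_ : Im _ = 0); last by rewrite !CE; ring.
    over.
  by rewrite Rintegral_cst// mul0r.
have E chi : texpo x chi * conjc (texpo y chi) = texpo (x - y) chi.
  have -> : texpo x chi = texpo (x - y) chi * texpo y chi.
    by rewrite -(bohr_char chi).2 subrK.
  have cc : texpo y chi * conjc (texpo y chi) = 1.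
    apply: Cplx_eqP; last by rewrite !CE; ring.
    by rewrite -sqmodE sqmod_bohr.
  by rewrite -mulrA cc mulr1.
have d0 : x - y != 0 by rewrite subr_eq0.
have [iR iI] : cintegrable muB (texpo (x - y)).
  apply: cintegrable_bounded; last by move=> chi; rewrite sqmod_bohr.
    by rewrite ltey_eq fin_num_measure.
  exact: cmeasurable_texpo.
rewrite /cinner; apply: Cplx_eqP => /=.
- under eq_Rintegral do rewrite E.
  by apply: (bohr_integral0 haar d0 (L := fun z => Re z)) => // z; rewrite CReN.
- under eq_Rintegral do rewrite E.
  by apply: (bohr_integral0 haar d0 (L := fun z => Im z)) => // z; rewrite CImN.
Qed.

End Bohr.

Theorem theorem4p3 (R : realType) (n : nat)
  (mu : {finite_measure set borelRn R n -> \bar R}%R)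
  (muB : probability (bohrB R n) R) (haar : is_haar muB)
  (Lam : set 'rV[R]_n) :
  orthonormal_exp mu Lam <->
  exists W : (borelRn R n -> Cplx R) -> (bohrB R n -> Cplx R),
    lin_isometry_exp mu muB Lam W.
Proof.
have mfin : (mu setT < +oo)%E by rewrite ltey_eq fin_num_measure.
have mfin' : (muB setT < +oo)%E by rewrite ltey_eq fin_num_measure.
have me := @cmeasurable_expo R n.
have me' := @cmeasurable_texpo R n.
have e1 (lam : 'rV[R]_n) (x : borelRn R n) : sqmod (expo lam x) = 1 by exact: sqmod_cexpi.
have e1' (lam : 'rV[R]_n) (chi : bohrB R n) : sqmod (texpo lam chi) = 1 by exact: sqmod_bohr.
(* Both directions hold because the Gram matrix of the characters is the identity. *)
split=> [orth|[W HW] lam lam' L1 L2].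
  have [lam lam' L1 L2|W HW] :=
      @isometry_of_gram _ _ _ _ _ _ _ _ _ _ Lam mfin mfin' me me' e1 e1'.
    by rewrite orth// texpo_orthonormal.
  by exists W; exact: HW.
by rewrite (gram_of_isometry mfin mfin' me me' e1 e1' HW)// texpo_orthonormal.
Qed.
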